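(* Let $\Omega$ be a finite set with $|\Omega|=n$, let $(H_i\mid i\in\Omega)$ be finite abelian groups with $h_i:=|H_i|\geqslant 2$ for all $i\in\Omega$, let $\mathbf{H}=\prod_{i\in\Omega}H_i$, and let $\mathbf{P}=(\Omega,\preccurlyeq_{\mathbf{P}})$ be a poset. Let $\Lambda$ be the dual partition of $\mathcal{Q}(\mathbf{H},\mathbf{P})$. Then the following are equivalent: (1) $\mathcal{Q}(\mathbf{H},\mathbf{P})$ is Fourier-reflexive; (2) $\Lambda=\mathcal{Q}(\hat{\mathbf{H}},\overline{\mathbf{P}})$; (3) $\mathbf{P}$ is hierarchical, and for any $u,v\in\Omega$ with $\mathrm{len}(u)=\mathrm{len}(v)$ we have $h_u=h_v$.
   Context: For a finite abelian group $H$, $\hat H$ is its character group (homomorphisms $H\to\mathbb{C}^*$). We identify $\hat{\mathbf{H}}$ with $\prod_{i\in\Omega}\hat{H_i}$ via $\alpha(\beta)=\prod_{i\in\Omega}\alpha_{(i)}(\beta_{(i)})$, and identify $\hat{\hat{H}}$ with $H$ canonically. For $\beta\in\mathbf{H}$, $\mathrm{supp}(\beta)=\{i\in\Omega:\beta_{(i)}\neq 1_{H_i}\}$; similarly for $\alpha\in\hat{\mathbf{H}}$, $\mathrm{supp}(\alpha)=\{i:\alpha_{(i)}\text{ is not the trivial character}\}$. For a poset $\mathbf{P}$ on $\Omega$ and $B\subseteq\Omega$, $\langle B\rangle_{\mathbf{P}}=\{a\in\Omega:\exists b\in B,\ a\preccurlyeq_{\mathbf{P}}b\}$. The $\mathbf{P}$-weight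 of a codeword is $\mathrm{wt}_{\mathbf{P}}(\beta)=|\langle\mathrm{supp}(\beta)\rangle_{\mathbf{P}}|$. $\mathcal{Q}(\mathbf{H},\mathbf{P})$ is the partition of $\mathbf{H}$ whose blocks are the sets of codewords of equal $\mathbf{P}$-weight; $\mathcal{Q}(\hat{\mathbf{H}},\overline{\mathbf{P}})$ is defined likewise on $\hat{\mathbf{H}}$ using the dual poset $\overline{\mathbf{P}}$ ($u\preccurlyeq_{\overline{\mathbf{P}}}v\iff v\preccurlyeq_{\mathbf{P}}u$). For a partition $\Gamma$ of a finite abelian group $H$, the dual partition $\widehat{\Gamma}$ is the partition of $\hat H$ with $\chi\sim\psi$ iff $\sum_{b\in B}\chi(b)=\sum_{b\in B}\psi(b)$ for all $B\in\Gamma$; the bidual partition $\widehat{\widehat{\Gamma}}$ is the partition of $H$ with $b\sim d$ iff $\sum_{\chi\in A}\chi(b)=\sum_{\chi\in A}\chi(d)$ for all $A\in\widehat\Gamma$. $\Gamma$ is Fourier-reflexive if $\widehat{\widehat{\Gamma}}=\Gamma$. For $y\in\Omega$, $\mathrm{len}(y)$ is the largest cardinality of a chain in $\mathbf{P}$ having $y$ as its greatest element. $\mathbf{P}$ is hierarchical if for all $u,v\in\Omega$ with $\mathrm{len}(u)+1\leqslant\mathrm{len}(v)$ we have $u\preccurlyeq_{\mathbf{P}}v$. *)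

(* Defs.v *)
From HB Require Import structures.
From mathcomp Require Import all_boot all_order all_algebra all_fingroup all_solvable all_field all_character.
Set Implicit Arguments. Unset Strict Implicit. Unset Printing Implicit Defensive.
Import Order.TTheory GRing.Theory Num.Theory.
Local Open Scope ring_scope.

Definition is_poset (I : finType) (le : rel I) : Prop :=
  [/\ reflexive le, (forall x y, le x y -> le y x -> x = y) & transitive le].

Definition dual_order (I : finType) (le : rel I) : rel I := fun u v => le v u.

Definition ideal (I : finType) (le : rel I) (B : {set I}) : {set I} :=
  [set a | [exists b in B, le a b]].

Definition chain_top (I : finType) (le : rel I) (C : {set I}) (y : I) : bool :=
  [&& y \in C, [forall c in C, le c y] & [forall c in C, forall d in C, le c d || le d c]].

Definition len (I : finType) (le : rel I) (y : I) : nat :=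
  \max_(C : {set I} | chain_top le C y) #|C|.

Definition hierarchical (I : finType) (le : rel I) : Prop :=
  forall u v, (len le u + 1 <= len le v)%N -> le u v.

(* A partition Gamma of a finite set X is encoded by its equivalence relation R
   (x ~ y iff x, y lie in the same block).  The pairing ev chi x = chi(x)
   between characters chi : Y and elements x : X.                          *)

(* dual partition: chi ~ psi iff sum_{b in B} chi b = sum_{b in B} psi b for every
   block B; the blocks are the classes {x | R b x} of the elements b. *)
Definition dual_rel (X Y : finType) (ev : Y -> X -> algC) (R : rel X) : rel Y :=
  fun chi psi => [forall b : X, \sum_(x | R b x) ev chi x == \sum_(x | R b x) ev psi x].

Definition bidual_rel (X Y : finType) (ev : Y -> X -> algC) (R : rel X) : rel X :=
  fun b d => [forall chi0 : Y,
    \sum_(chi | dual_rel ev R chi0 chi) ev chi b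
      == \sum_(chi | dual_rel ev R chi0 chi) ev chi d].

Definition fourier_reflexive (X Y : finType) (ev : Y -> X -> algC) (R : rel X) : Prop :=
  forall b d, bidual_rel ev R b d = R b d.

Definition prodH (I : finType) (H : I -> finGroupType) : finType :=
  {dffun forall i : I, H i}.

(* hat H_i is indexed by Iirr [set: H i] (all irreducible characters of an abelian
   group are exactly its linear characters, i.e. homomorphisms to C^* );
   hat H is identified with prod_i hat H_i. *)
Definition prodHhat (I : finType) (H : I -> finGroupType) : finType :=
  {dffun forall i : I, Iirr [set: H i]%G}.

Definition char_ev (I : finType) (H : I -> finGroupType)
  (a : prodHhat H) (b : prodH H) : algC :=
  \prod_(i : I) 'chi_(a i) (b i).

Definition supp_el (I : finType) (H : I -> finGroupType) (b : prodH H) : {set I} :=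
  [set i | b i != 1%g].

Definition supp_ch (I : finType) (H : I -> finGroupType) (a : prodHhat H) : {set I} :=
  [set i | 'chi_(a i) != 1].

Definition wt_el (I : finType) (H : I -> finGroupType) (le : rel I) (b : prodH H) : nat :=
  #|ideal le (supp_el b)|.

Definition wt_ch (I : finType) (H : I -> finGroupType) (le : rel I) (a : prodHhat H) : nat :=
  #|ideal le (supp_ch a)|.

Definition Qrel (I : finType) (H : I -> finGroupType) (le : rel I) : rel (prodH H) :=
  fun b d => wt_el le b == wt_el le d.

Definition Qhat_rel (I : finType) (H : I -> finGroupType) (le : rel I) : rel (prodHhat H) :=
  fun a c => wt_ch (dual_order le) a == wt_ch (dual_order le) c.

(* Main.v *)
Require Import Defs.
From HB Require Import structures.
From mathcomp Require Import all_boot all_order all_algebra all_fingroup all_solvable all_field all_character.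
Set Implicit Arguments. Unset Strict Implicit. Unset Printing Implicit Defensive.
Import Order.TTheory GRing.Theory Num.Theory.
Local Open Scope ring_scope.

(** The sum of a character [a] over the codewords whose support satisfies a
    predicate only depends on the support of [a], and the same holds with the
    roles of characters and codewords exchanged; so everything becomes a
    statement about sums over subsets of the index set.

    If the order is a weak order (incomparability is transitive, a self-dual
    reformulation of "hierarchical") and the group sizes agree on incomparable
    indices, the block sums of [a] only depend on the size of the up-set
    generated by its support: transpositions of incomparable indices are
    automorphisms.  Applied to the order and to its dual, and combined with Fourier
    inversion, this shows that the two weight partitions are dual to each other.

    Conversely, let [L] be a set all of whose elements lie below everything
    outside [L], and let [M] be the set of minimal elements outside [L].  The
    characters trivial on [L] and nontrivial on [M] form a block of the dual
    partition, and their sum at a codeword has an explicit product form.  If it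
    only depends on the weight, then all groups indexed by [M] have the same size,
    and [M] lies below everything outside [L :|: M]; so the order can be peeled off
    level by level. *)

(** * Dual partitions *)

Lemma equivalence_rel_sym (T : Type) (S : rel T) :
  equivalence_rel S -> symmetric S.
Proof.
have impS y z : equivalence_rel S -> S y z -> S z y.
  by move=> eqS yz; rewrite -((eqS y z y).2 yz) (eqS y y y).1.
by move=> eqS y z; apply/idP/idP; apply: impS.
Qed.

(** Since [u] is constant on the classes of [S], replacing [F] by its average over each class leaves
    the weighted sum unchanged. *)
Lemma eq_sum_classes (Y : finType) (S : rel Y) (u F G : Y -> algC) :
  equivalence_rel S -> (forall y z, S y z -> u y = u z) ->
  (forall y0, \sum_(y | S y0 y) F y = \sum_(y | S y0 y) G y) ->
  \sum_y u y * F y = \sum_y u y * G y.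
Proof.
move=> eqS uS FG.
have refS y : S y y by case: (eqS y y y).
have symS := equivalence_rel_sym eqS.
have cardS y z : S y z -> #|S y| = #|S z|.
  by move=> yz; apply: eq_card => t; rewrite /in_mem /= (eqS y z t).2.
have cls (K : Y -> algC) :
    \sum_y u y * K y = \sum_y u y / #|S y|%:R * \sum_(z | S y z) K z.
  transitivity (\sum_z \sum_(y | S y z) u y / #|S y|%:R * K z); last first.
    rewrite (exchange_big_dep predT) //=; apply: eq_bigr => y _.
    by rewrite mulr_sumr.
  apply: eq_bigr => z _.
  under eq_bigr => y yz do rewrite (uS _ _ yz) (cardS _ _ yz).
  rewrite (eq_bigl (mem (S z))); last by move=> y; rewrite symS.
  rewrite sumr_const -[RHS]mulr_natl mulrA [u z / _]mulrC mulVKf //.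
  by rewrite pnatr_eq0 -lt0n; apply/card_gt0P; exists z; exact: refS.
by rewrite !cls; apply: eq_bigr => y _; rewrite FG.
Qed.

Section DualRelations.

Variables (X Y : finType) (ev : Y -> X -> algC).
Implicit Types R : rel X.

Lemma dual_rel_equiv R : equivalence_rel (dual_rel ev R).
Proof.
move=> a b c; split; first exact/forallP.
move=> /forallP ab; apply/forallP/forallP => H z; first by rewrite -(eqP (ab z)).
by rewrite (eqP (ab z)).
Qed.

(* Fourier inversion recovers the indicator function of a block of [R] from its
   transform, and the conjugate of that transform is constant on dual blocks. *)
Lemma bidual_rel_sub R (N : algC) b d :
  N != 0 -> reflexive R ->
  (forall x x', \sum_y ev y x * (ev y x')^* = N *+ (x == x')) ->
  bidual_rel ev R b d -> R b d.
Proof.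
move=> N0 refR orth /forallP bd.
pose u y := (\sum_(x | R b x) ev y x)^*.
have inv e : \sum_y u y * ev y e = N *+ R b e.
  rewrite /u; under eq_bigr do rewrite rmorph_sum mulr_suml.
  rewrite exchange_big /=.
  under eq_bigr => x _ do under eq_bigr do rewrite mulrC.
  under eq_bigr => x _ do rewrite orth.
  have [Rbe|nRbe] := boolP (R b e).
    rewrite (bigD1 e) //= eqxx big1 ?addr0 // => x /andP[_ nxe].
    by rewrite eq_sym (negbTE nxe).
  by rewrite big1 // => x Rbx; case: eqP => // ex; rewrite ex Rbx in nRbe.
have := inv b; rewrite refR.
rewrite (@eq_sum_classes Y (dual_rel ev R) u (ev^~ b) (ev^~ d)) //.
- by rewrite inv; case: (R b d) => //= /eqP; rewrite mulr1n mulr0n eq_sym (negbTE N0).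
- exact: dual_rel_equiv.
- by move=> y z /forallP/(_ b)/eqP yz; rewrite /u yz.
- by move=> y0; apply/eqP.
Qed.

(** A block of the coarser [R'] is a union of blocks of [R], so its indicator is constant on the
    classes of [R]. *)
Lemma dual_rel_mono R R' a c :
  equivalence_rel R -> equivalence_rel R' -> subrel R R' ->
  dual_rel ev R a c -> dual_rel ev R' a c.
Proof.
move=> eqR eqR' RR' /forallP ac; apply/forallP => b; apply/eqP.
have E y : \sum_(x | R' b x) ev y x = \sum_x (R' b x)%:R * ev y x.
  by rewrite big_mkcond; apply: eq_bigr => x _; case: (R' b x); rewrite ?mul1r ?mul0r.
rewrite !E.
apply: (eq_sum_classes eqR) => [x z xz|x]; last exact/eqP.
by rewrite !(equivalence_rel_sym eqR' b) ((eqR' x z b).2 (RR' _ _ xz)).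
Qed.

End DualRelations.

(** Dualizing [R] contained in the dual of [R'] puts the dual of [R] inside the bidual of [R'],
    hence inside [R']. Once [R'] is known to be the dual of [R], the dual of [R'] is the bidual of
    [R]. *)
Lemma mutual_duality (X Y : finType) (ev : Y -> X -> algC) (R : rel X) (R' : rel Y) :
  let ve x y := ev y x in
  equivalence_rel R -> equivalence_rel R' ->
  subrel R' (dual_rel ev R) -> subrel R (dual_rel ve R') ->
  subrel (bidual_rel ev R) R -> subrel (bidual_rel ve R') R' ->
  dual_rel ev R =2 R' /\ fourier_reflexive ev R.
Proof.
move=> ve eqR eqR' R'R RR' biR biR'.
have dR : dual_rel ev R =2 R'.
  move=> a c; apply/idP/idP => [ac|]; last exact: R'R.
  apply/biR'/(dual_rel_mono _ _ _ ac) => //; exact: dual_rel_equiv.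
split=> // b d; apply/idP/idP => [/biR //|/RR'/forallP bd].
apply/forallP => a; have := bd a.
by rewrite !(eq_bigl _ _ (dR a)).
Qed.

(** * Sums over products of finite groups *)

Section Distributivity.

Variables (I : finType).

Lemma prod_sum_dffun (X : I -> finType) (F : forall i, X i -> algC) :
  \prod_i \sum_(x : X i) F i x = \sum_(f : {dffun forall i, X i}) \prod_i F i (f i).
Proof.
(* Through [fprod], dependent functions become functions into one tagged type, where ordinary
   distributivity applies. *)
rewrite (reindex (@dffun_of_fprod I X)); last exact/onW_bij/dffun_of_fprod_bij.
pose G i := [ffun x : X i => F i x].
transitivity (\sum_(t : fprod X) \prod_(i in I) G i (t i)); last first.
  by apply: eq_bigr => t _; apply: eq_bigr => i _; rewrite !ffunE.
rewrite big_fprod.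
rewrite -(bigA_distr_big_dep (fun i => [in tagged_with X i])
            (fun i => untag 0 (G i))).
apply: eq_bigr => i _.
apply: etrans (big_tag (fun i => G i : X i -> algC) i).
by apply: eq_bigr => x _; rewrite ffunE.
Qed.

Lemma sum_prod_interval (A B : {set I}) (c : I -> algC) : A \subset B ->
  \sum_(S : {set I} | (A \subset S) && (S \subset B)) \prod_(i in S) c i
  = \prod_(i in A) c i * \prod_(i in B :\: A) (1 + c i).
Proof.
move=> /subsetP sAB.
(* Expanding, the first summand is chosen for [i] in [S] and the second for [i] outside; a zero
   appears as soon as [S] leaves [B] or misses a point of [A]. *)
transitivity (\prod_i ((if i \in B then c i else 0) + (i \notin A)%:R)).
  rewrite bigA_distr big_mkcond; apply: eq_bigr => S _.
  case: ifP => [/andP[/subsetP AS /subsetP SB]|].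
    rewrite big_mkcond; apply: eq_bigr => i _.
    case: ifP => [iS|niS]; first by rewrite SB.
    by case: (boolP (i \in A)) => // /AS; rewrite niS.
  move=> nS; apply/esym/eqP/prodf_eq0.
  move/negbT: nS; rewrite negb_and => /orP[] /subsetPn[i i1 i2]; exists i => //.
    by rewrite (negbTE i2) i1.
  by rewrite i1 (negbTE i2).
rewrite (bigID (mem A)) /=; congr (_ * _).
  by apply: eq_bigr => i iA; rewrite sAB // iA addr0.
rewrite big_mkcond [RHS]big_mkcond; apply: eq_bigr => i _.
rewrite inE; case: (i \in A) => //=.
by case: (i \in B); rewrite ?add0r // addrC.
Qed.

End Distributivity.

Section Pairing.

Variables (I : finType) (X Y : I -> finType).
Variables (x0 : forall i, X i) (y0 : forall i, Y i).
Variables (ev : forall i, Y i -> X i -> algC) (h : I -> nat).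

Definition dsupp (Z : I -> finType) (z0 : forall i, Z i)
  (b : {dffun forall i, Z i}) : {set I} := [set i | b i != z0 i].

(* The sum of a character of the [i]-th group over the nontrivial elements, when
   the character is nontrivial exactly for [i \in T]. *)
Definition punctured_sum (h : I -> nat) (T : {set I}) (i : I) : algC :=
  if i \in T then -1 else (h i)%:R - 1.

(** For a fixed support [E] the sum factors over the indices: 1 outside [E], and inside it the full
    sum minus the value 1 at the base point. The pairing is abstract so that characters and
    codewords can exchange roles. *)
Lemma sum_over_support (p : pred {set I}) (a : {dffun forall i, Y i}) :
  (forall i y, ev y (x0 i) = 1) ->
  (forall i y, \sum_x ev y x = (h i)%:R *+ (y == y0 i)) ->
  \sum_(b : {dffun forall i, X i} | p (dsupp x0 b)) \prod_i ev (a i) (b i)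
  = \sum_(E | p E) \prod_(i in E) punctured_sum h (dsupp y0 a) i.
Proof.
move=> ev1 evS.
rewrite (partition_big (dsupp x0) p) //=; apply: eq_bigr => E pE.
transitivity (\prod_i \sum_(x : X i | (i \in E) == (x != x0 i)) ev (a i) x).
  under [RHS]eq_bigr do rewrite big_mkcond.
  rewrite prod_sum_dffun big_mkcond; apply: eq_bigr => b _.
  case: ifP => [/andP[_ /eqP bE]|bE].
    by apply: eq_bigr => i _; rewrite -bE inE eqxx.
  apply/esym/eqP/prodf_eq0.
  have /existsP[i iE] : [exists i, (i \in E) != (b i != x0 i)].
    apply: contraFT bE; rewrite negb_exists => /forallP bE.
    have -> : dsupp x0 b = E; last by rewrite eqxx andbT.
    by apply/setP => i; rewrite inE; apply/esym/eqP; have := bE i; rewrite negbK.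
  by exists i => //; rewrite (negbTE iE).
rewrite [RHS]big_mkcond; apply: eq_bigr => i _.
case: (i \in E); last first.
  rewrite (eq_bigl (pred1 (x0 i))) ?big_pred1_eq ?ev1 // => x.
  by rewrite /=; case: (x == x0 i).
rewrite (eq_bigl (fun x => x != x0 i)); last by move=> x; case: (x == x0 i).
rewrite /punctured_sum inE.
have := evS i (a i); rewrite (bigD1 (x0 i)) //= ev1 => /(canRL (addKr 1)) ->.
by case: eqP => _; rewrite ?mulr1n ?mulr0n ?addr0 // addrC.
Qed.

Lemma orthogonality_prod (b b' : {dffun forall i, X i}) :
  (forall i x x', \sum_(y : Y i) ev y x * (ev y x')^* = (h i)%:R *+ (x == x')) ->
  \sum_(a : {dffun forall i, Y i})
     (\prod_i ev (a i) (b i)) * (\prod_i ev (a i) (b' i))^*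
  = (\prod_i (h i)%:R) *+ (b == b').
Proof.
move=> orth.
transitivity (\prod_i \sum_(y : Y i) ev y (b i) * (ev y (b' i))^*).
  rewrite prod_sum_dffun; apply: eq_bigr => a _.
  by rewrite big_split /= rmorph_prod.
under eq_bigr do rewrite orth.
case: eqP => [->|/eqP nbb]; first by apply: eq_bigr => i _; rewrite eqxx.
apply/eqP/prodf_eq0.
have /existsP[i iE] : [exists i, b i != b' i].
  apply: contraNT nbb; rewrite negb_exists => /forallP bE.
  by apply/eqP/ffunP => i; apply/eqP; have := bE i; rewrite negbK.
by exists i => //; rewrite (negbTE iE).
Qed.

End Pairing.

(** * Weak orders *)

Definition strict (I : finType) (le : rel I) : rel I :=
  fun u v => le u v && (u != v).

(** Contrapositively, [~~ strict le] is transitive. Avoiding [len], which is not symmetric under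
    reversal, makes the condition visibly self-dual. *)
Definition weak_order (I : finType) (le : rel I) : Prop :=
  forall u v w, strict le u v -> strict le u w || strict le w v.

Definition constant_on_incomparable (I : finType) (le : rel I) (h : I -> nat) : Prop :=
  forall u v, ~~ strict le u v -> ~~ strict le v u -> h u = h v.

Section Dualization.

Variables (I : finType) (le : rel I).

Lemma strict_dual u v : strict (dual_order le) u v = strict le v u.
Proof. by rewrite /strict /dual_order eq_sym. Qed.

Lemma is_poset_dual : is_poset le -> is_poset (dual_order le).
Proof.
by case=> r a t; split=> // [x y xy yx|y x z xy yz]; [exact: a | exact: t yz xy].
Qed.

Lemma weak_order_dual : weak_order le -> weak_order (dual_order le).
Proof. by move=> wo u v w; rewrite !strict_dual orbC; apply: wo. Qed.

Lemma constant_on_incomparable_dual h :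
  constant_on_incomparable le h -> constant_on_incomparable (dual_order le) h.
Proof. by move=> hc u v; rewrite !strict_dual => *; apply: hc. Qed.

End Dualization.

Section Poset.

Variables (I : finType) (le : rel I).
Hypothesis po : is_poset le.

Let le_refl x : le x x. Proof. by case: po => r _ _. Qed.
Let le_anti x y : le x y -> le y x -> x = y. Proof. by case: po => _ a _; apply: a. Qed.
Let le_trans y x z : le x y -> le y z -> le x z. Proof. by case: po => _ _ t; apply: t. Qed.

Lemma strict_le u v : strict le u v -> le u v. Proof. by case/andP. Qed.

Lemma strict_irr u : strict le u u = false. Proof. by rewrite /strict eqxx andbF. Qed.

Lemma le_strict_trans v u w : le u v -> strict le v w -> strict le u w.
Proof.
move=> uv /andP[vw nvw]; rewrite /strict (le_trans uv vw).
by apply: contraNneq nvw => uw; rewrite (@le_anti v w) // -uw.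
Qed.

Lemma idealP (B : {set I}) a :
  reflect (exists2 b, b \in B & le a b) (a \in ideal le B).
Proof. by rewrite inE; apply: exists_inP. Qed.

Lemma sub_ideal (B : {set I}) : B \subset ideal le B.
Proof. by apply/subsetP => b bB; apply/idealP; exists b. Qed.

Lemma ideal_closed (B : {set I}) x y : x \in ideal le B -> le y x -> y \in ideal le B.
Proof.
by move=> /idealP[b bB xb] yx; apply/idealP; exists b => //; apply: le_trans xb.
Qed.

Lemma ideal_sub (B C : {set I}) :
  (forall x y, x \in C -> le y x -> y \in C) -> (ideal le B \subset C) = (B \subset C).
Proof.
move=> Cc; apply/idP/idP => [/(subset_trans (sub_ideal B)) //|/subsetP BC].
by apply/subsetP => x /idealP[b /BC bC xb]; apply: Cc xb.
Qed.

Lemma chain_top1 y : chain_top le [set y] y.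
Proof.
apply/and3P; split; first exact: set11.
  by apply/forall_inP => c /set1P ->.
apply/forall_inP => c /set1P ->; apply/forall_inP => d /set1P ->.
by rewrite le_refl.
Qed.

Lemma len_witness y : exists2 C : {set I}, chain_top le C y & len le y = #|C|.
Proof.
rewrite /len (bigop.bigmax_eq_arg [set y]) ?chain_top1 //.
by case: arg_maxnP => [|C CC _]; [exact: chain_top1 | exists C].
Qed.

Lemma chain_top_len C y : chain_top le C y -> (#|C| <= len le y)%N.
Proof. by move=> CC; rewrite /len (bigop.bigmax_sup C). Qed.

Lemma chain_top_extend (C : {set I}) (y : I) :
  (forall c, c \in C -> strict le c y) ->
  (forall c d, c \in C -> d \in C -> le c d || le d c) ->
  chain_top le (y |: C) y /\ #|y |: C| = #|C|.+1.
Proof.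
move=> Cy CC; split; last first.
  by rewrite cardsU1 (_ : y \notin C) //; apply/negP => /Cy; rewrite strict_irr.
apply/and3P; split; first exact: setU11.
  by apply/forall_inP => c /setU1P[->//|/Cy/strict_le].
apply/forall_inP => c /setU1P cC; apply/forall_inP => d /setU1P dC.
case: cC dC => [->|cC] [->|dC]; rewrite ?le_refl //; last exact: CC.
  by rewrite (strict_le (Cy _ dC)) orbT.
by rewrite (strict_le (Cy _ cC)).
Qed.

Lemma len_strict u v : strict le u v -> (len le u < len le v)%N.
Proof.
move=> uv; have [C /and3P[uC /forall_inP Cu /forall_inP CC] ->] := len_witness u.
have [||ct <-] := @chain_top_extend C v; last exact: chain_top_len.
  by move=> c /Cu cu; apply: le_strict_trans uv.
by move=> c d /CC/forall_inP; apply.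
Qed.

(** In a longest chain with top [v], the top can be exchanged for [u]: whatever lies strictly below
    [v] lies strictly below [u], as [u] is not strictly below [v]. *)
Lemma weak_order_len u v :
  weak_order le -> ~~ strict le u v -> (len le v <= len le u)%N.
Proof.
move=> wo nuv; have [C /and3P[vC /forall_inP Cv /forall_inP CC] ->] := len_witness v.
have [||ct] := @chain_top_extend (C :\ v) u.
- move=> c /setD1P[ncv /Cv cv]; have scv : strict le c v by rewrite /strict cv.
  by case/orP: (wo c v u scv) => // uv; rewrite uv in nuv.
- by move=> c d /setD1P[_ /CC/forall_inP H] /setD1P[_ /H].
by rewrite [#|C|](cardsD1 v) vC add1n => <-; apply: chain_top_len.
Qed.

(** Being hierarchical and being a weak order both amount to [strict le u v] being equivalent to
    [len le u < len le v]; incomparability then means equal length. *)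
Lemma hierarchicalP (h : I -> nat) :
  hierarchical le /\ (forall u v, len le u = len le v -> h u = h v)
  <-> weak_order le /\ constant_on_incomparable le h.
Proof.
split=> [[hi hh]|[wo hc]]; split.
- move=> u v w /len_strict uv; rewrite /strict.
  have [uw|wu] := ltnP (len le u) (len le w).
    rewrite hi ?addn1 //; case: eqP => // e; by rewrite e ltnn in uw.
  have wv := leq_ltn_trans wu uv.
  rewrite (hi w v) ?addn1 //; case: (w =P v) => [e|]; last by rewrite orbT.
  by rewrite e ltnn in wv.
- move=> u v nuv nvu; apply: hh; apply/eqP; rewrite eqn_leq; apply/andP.
  have H a b : ~~ strict le a b -> (len le b <= len le a)%N.
    rewrite leqNgt; apply: contra => ab; rewrite /strict hi ?addn1 //.
    by case: eqP ab => // ->; rewrite ltnn.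
  by split; apply: H.
- move=> u v; rewrite addn1 => uv; apply: strict_le.
  by apply: contraLR uv => nuv; rewrite -leqNgt weak_order_len.
- move=> u v e; apply: hc; apply/negP => /len_strict; by rewrite e ltnn.
Qed.

End Poset.

(** * Block sums of a weight partition *)

Section WeightSums.

Variables (I : finType) (h : I -> nat) (le : rel I).
Hypothesis po : is_poset le.
Local Notation c := (punctured_sum h).
Local Notation up := (ideal (dual_order le)).

Let le_refl x : le x x. Proof. by case: po => r _ _. Qed.

Definition weight_sum (k : nat) (S : {set I}) : algC :=
  \sum_(E : {set I} | #|ideal le E| == k) \prod_(i in E) c S i.

(* Toggling the membership of [s] does not change the ideal of a set that contains
   [y] and changes the sign of the product. *)
Lemma weight_sum_above0 k (S : {set I}) s y :
  s \in S -> strict le s y ->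
  \sum_(E : {set I} | (#|ideal le E| == k) && (y \in E)) \prod_(i in E) c S i = 0.
Proof.
move=> sS /andP[sy nsy].
rewrite (bigID (fun E : {set I} => s \in E)) /=.
have -> : \sum_(E : {set I} | (#|ideal le E| == k) && (y \in E) && (s \in E))
              \prod_(i in E) c S i
    = \sum_(E : {set I} | (#|ideal le E| == k) && (y \in E) && (s \notin E))
        \prod_(i in s |: E) c S i.
  rewrite (reindex_onto (fun E => s |: E) (fun E => E :\ s)); last first.
    by move=> E /andP[_ sE]; rewrite setD1K.
  apply: eq_bigl => E.
  rewrite setU11 andbT in_setU1 [y == s]eq_sym (negbTE nsy) /=.
  have -> : ((s |: E) :\ s == E) = (s \notin E).
    apply/eqP/idP => [<-|sE]; first by rewrite setD11.
    by rewrite setU1K.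
  case: (boolP (y \in E)) => [yE|]; last by rewrite !andbF.
  have -> // : ideal le (s |: E) = ideal le E.
  apply/setP => a; apply/idealP/idealP => [[b]|[b bE ab]]; last first.
    by exists b => //; rewrite in_setU1 bE orbT.
  case/setU1P => [->|bE] ab; last by exists b.
  by exists y => //; case: po => _ _ t; apply: t ab sy.
rewrite -big_split big1 //= => E /andP[_ sE].
by rewrite big_setU1 //= {1}/punctured_sum sS mulN1r addNr.
Qed.

(** Sets [E] containing [y] contribute 0 on both sides by cancellation, and the products over the
    other sets do not see whether [y] belongs to [S]. *)
Lemma weight_sum_add k (S : {set I}) s y :
  s \in S -> strict le s y -> weight_sum k (y |: S) = weight_sum k S.
Proof.
move=> sS sy; rewrite /weight_sum (bigID (fun E : {set I} => y \in E)) /=.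
rewrite [RHS](bigID (fun E : {set I} => y \in E)) /=.
rewrite (weight_sum_above0 k sS sy) (@weight_sum_above0 _ _ s) ?in_setU1 ?sS ?orbT //.
congr (_ + _); apply: eq_bigr => E /andP[_ yE]; apply: eq_bigr => i iE.
rewrite /punctured_sum in_setU1; case: eqP => // iy.
by rewrite -iy iE in yE.
Qed.

Lemma weight_sum_up k (S : {set I}) : weight_sum k S = weight_sum k (up S).
Proof.
(* The elements of [up S] are added to [S] one at a time, along a list. *)
suff H (s : seq I) : {subset s <= up S} ->
    weight_sum k ([set x in s] :|: S) = weight_sum k S.
  rewrite -(H (enum (up S))) => [|x]; last by rewrite mem_enum.
  rewrite set_enum; congr weight_sum; apply/setUidPl.
  exact/sub_ideal/is_poset_dual.
elim: s => [_|y s IHs ys]; first by rewrite set_nil set0U.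
rewrite set_cons -setUA -[RHS]IHs; last by move=> x xs; apply: ys; rewrite inE xs orbT.
have /idealP[t tS ty] := ys y (mem_head y s).
have [ety|nty] := eqVneq t y.
  by congr weight_sum; apply/setUidPr; rewrite sub1set inE -ety tS orbT.
by apply: (@weight_sum_add _ _ t); rewrite ?inE ?tS ?orbT // /strict nty andbT.
Qed.

Lemma weight_sum_perm k (s : {perm I}) (S : {set I}) :
  (forall x y, le (s x) (s y) = le x y) -> (forall x, h (s x) = h x) ->
  weight_sum k (s @: S) = weight_sum k S.
Proof.
move=> les hs; rewrite /weight_sum.
have inj_s := @perm_inj _ s.
rewrite (reindex_onto (fun E : {set I} => s @: E) (fun E : {set I} => s @^-1: E)); last first.
  by move=> E _; apply/setP => x; rewrite -[x](permKV s) mem_imset // inE.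
apply: eq_big => [E|E _].
  have -> : s @^-1: (s @: E) = E by apply/setP => x; rewrite inE mem_imset.
  rewrite eqxx andbT -(card_imset (ideal le E) inj_s).
  congr (_ == _); congr #|pred_of_set _|; apply/setP => x; rewrite -[x](permKV s).
  rewrite mem_imset //; apply/idealP/idealP => [[_ /imsetP[b bE ->]]|[b bE]].
    by rewrite les; exists b.
  by exists (s b); rewrite ?imset_f ?les.
rewrite big_imset /=; last by move=> x y _ _ /inj_s.
by apply: eq_bigr => i _; rewrite /punctured_sum mem_imset // hs.
Qed.

(** In a weak order, incomparable elements have the same elements strictly below them and the same
    strictly above. *)
Lemma weak_order_tperm u v : weak_order le ->
  ~~ strict le u v -> ~~ strict le v u ->
  forall x y, le (tperm u v x) (tperm u v y) = le x y.
Proof.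
move=> wo nuv nvu.
have leE x y : le x y = (x == y) || strict le x y.
  by rewrite /strict; case: eqP => [->|]; rewrite ?le_refl ?andbT.
have below a b x : ~~ strict le b a -> strict le x a -> strict le x b.
  by move=> nba /(wo _ _ b)/orP[//|ba]; rewrite ba in nba.
have above a b x : ~~ strict le a b -> strict le a x -> strict le b x.
  by move=> nab /(wo _ _ b)/orP[ab|//]; rewrite ab in nab.
have belowE x : strict le x u = strict le x v by apply/idP/idP; apply: below.
have aboveE x : strict le u x = strict le v x by apply/idP/idP; apply: above.
move=> x y; rewrite !leE (inj_eq perm_inj); congr (_ || _).
by case: tpermP => [->|->|_ _]; case: tpermP => [->|->|_ _];
   rewrite ?belowE ?aboveE ?strict_irr.
Qed.

(** By [weight_sum_up] only two up-sets [U] and [V] of equal size have to be compared. An element of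
    [U :\: V] and one of [V :\: U] are incomparable because both sets are closed; swapping them in
    [U] gives an up-set closer to [V]. *)
Lemma weight_sum_card k (S T : {set I}) :
  weak_order le -> constant_on_incomparable le h ->
  #|up S| = #|up T| -> weight_sum k S = weight_sum k T.
Proof.
move=> wo hc; rewrite (weight_sum_up k S) (weight_sum_up k T).
have pod := is_poset_dual po.
pose closed (U : {set I}) := forall x y, x \in U -> le x y -> y \in U.
have : closed (up S) by move=> x y xU xy; apply: (ideal_closed pod) xU xy.
have : closed (up T) by move=> x y xU xy; apply: (ideal_closed pod) xU xy.
move: (up S) (up T) => U V cV.
have [n] := ubnP #|U :\: V|; elim: n U => // n IHn U leUV cU eUV.
have [UV|/subsetPn[u uU nuV]] := boolP (U \subset V).
  by have /eqP -> : U == V by rewrite eqEcard UV eUV leqnn.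
have /subsetPn[v vV nvU] : ~~ (V \subset U).
  apply: contraNN nuV => VU.
  by have /eqP -> : V == U by rewrite eqEcard VU eUV leqnn.
have nuv : ~~ strict le u v.
  by apply: contra nvU => /strict_le; apply: cU.
have nvu : ~~ strict le v u.
  by apply: contra nuV => /strict_le; apply: cV.
have les := weak_order_tperm wo nuv nvu.
have inj_s := @perm_inj _ (tperm u v).
rewrite -(@weight_sum_perm k (tperm u v) U) //; last first.
  by move=> x; case: tpermP => // ->; apply: hc.
have mem_s x : (x \in tperm u v @: U) = (tperm u v x \in U).
  by rewrite -{1}[x](tpermK u v) mem_imset.
apply: IHn; last by rewrite card_imset.
- rewrite -ltnS; apply: leq_trans _ leUV; rewrite ltnS; apply: proper_card; apply/properP; split.
    apply/subsetP => x; rewrite !inE mem_s => /andP[nxV].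
    by case: tpermP nxV => [->|->|_ _ ->]; rewrite ?(negbTE nvU) ?vV //= => ->.
  by exists u; rewrite !inE ?nuV ?uU // mem_s tpermL (negbTE nvU).
- by move=> x y; rewrite !mem_s => xU xy; apply: cU xU _; rewrite les.
Qed.

End WeightSums.

(** * Peeling off the levels *)

Section Cuts.

Variables (I : finType) (h : I -> nat) (le : rel I).
Hypotheses (po : is_poset le) (h_ge2 : forall i, (2 <= h i)%N).
Local Notation c := (punctured_sum h).
Local Notation up := (ideal (dual_order le)).

Let le_refl x : le x x. Proof. by case: po => r _ _. Qed.
Let le_anti x y : le x y -> le y x -> x = y. Proof. by case: po => _ a _; apply: a. Qed.
Let le_trans y x z : le x y -> le y z -> le x z. Proof. by case: po => _ _ t; apply: t. Qed.

Implicit Types L S T : {set I}.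

Definition cut (L : {set I}) : Prop := forall x y, x \in L -> y \notin L -> le x y.

Definition min_above (L : {set I}) : {set I} :=
  [set m in ~: L | [forall x in ~: L, le x m ==> (x == m)]].

Lemma cut_closed L x y : cut L -> x \in L -> le y x -> y \in L.
Proof.
move=> cL xL yx; apply: contraT => nyL.
by have yx' := le_anti yx (cL _ _ xL nyL); rewrite yx' xL in nyL.
Qed.

Lemma min_aboveP L m :
  reflect (m \notin L /\ forall x, x \notin L -> le x m -> x = m) (m \in min_above L).
Proof.
rewrite !inE; apply: (iffP andP) => -[mL H]; split => //.
  by move=> x nxL xm; apply/eqP; move/forall_inP/(_ x): H; rewrite inE xm; apply.
by apply/forall_inP => x; rewrite inE => nxL; apply/implyP => xm; apply/eqP/H.
Qed.

Lemma exists_minimal (A : pred I) x : A x ->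
  exists m, [/\ A m, le m x & forall y, A y -> le y m -> y = m].
Proof.
move=> Ax; pose B y := A y && le y x.
have Bx : B x by rewrite /B Ax le_refl.
(* An element of [B] whose principal ideal has least cardinality is minimal. *)
case: (arg_minnP (fun y => #|ideal le [set y]|) Bx) => m /andP[Am mx] min_m.
exists m; split=> // y Ay ym; apply: le_anti => //.
have By : B y by rewrite /B Ay (le_trans ym mx).
have yi_mi : ideal le [set y] \subset ideal le [set m].
  apply/subsetP => z /idealP[_ /set1P-> zy]; apply/idealP.
  by exists m; [exact: set11 | exact: le_trans ym].
have /eqP E : ideal le [set y] == ideal le [set m] by rewrite eqEcard yi_mi min_m.
have : m \in ideal le [set y] by rewrite E; apply/idealP; exists m; rewrite ?set11.
by case/idealP => _ /set1P->.
Qed.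

Lemma min_above_below L x : x \notin L -> exists2 m, m \in min_above L & le m x.
Proof.
case/(@exists_minimal (fun x => x \notin L)) => m [nmL mx min_m].
by exists m => //; apply/min_aboveP.
Qed.

(** The complement of a cut is an up-set, generated by its minimal elements, and a minimal element
    is only generated by itself. *)
Lemma up_eq_setC L (S : {set I}) : cut L ->
  (up S == ~: L) = (min_above L \subset S) && (S \subset ~: L).
Proof.
move=> cL; apply/eqP/andP => [upS|[/subsetP MS SL]]; last first.
  apply/eqP; rewrite eqEsubset; apply/andP; split.
    rewrite (ideal_sub (is_poset_dual po)) // => x y; rewrite !inE.
    by move=> nxL xy; apply: contra nxL => yL; apply: cut_closed xy.
  apply/subsetP => x; rewrite inE => /min_above_below[m /MS mS mx].
  by apply/idealP; exists m.
split; last by rewrite -upS; apply/sub_ideal/is_poset_dual.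
apply/subsetP => m /min_aboveP[nmL min_m].
have /idealP[s sS sm] : m \in up S by rewrite upS inE.
rewrite -(min_m s) //.
have : s \in up S by apply: (subsetP (sub_ideal (is_poset_dual po) S)).
by rewrite upS inE.
Qed.

(** Weights only record cardinalities. If [S] had a point [s] in [L], then [up S] would contain [s]
    besides all of [~: L], and be too large. *)
Lemma up_card_setC L (S : {set I}) : cut L -> (#|up S| == #|~: L|) = (up S == ~: L).
Proof.
move=> cL; apply/eqP/eqP => [eS|-> //]; apply/eqP.
have pod := is_poset_dual po.
have [SL|/subsetPn[s sS]] := boolP (S \subset ~: L).
  rewrite eqEcard eS leqnn andbT (ideal_sub pod) // => x y; rewrite !inE.
  by move=> nxL xy; apply: contra nxL => yL; apply: cut_closed xy.
rewrite inE negbK => sL.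
have : (#|s |: ~: L| <= #|up S|)%N.
  apply/subset_leq_card/subsetP => x /setU1P[->|]; first exact: (subsetP (sub_ideal pod S)).
  by rewrite inE => nxL; apply/idealP; exists s => //; apply: cL.
by rewrite cardsU1 inE sL eS ltnn.
Qed.

Lemma sum_up_setC L (c' : I -> algC) : cut L ->
  \sum_(S | up S == ~: L) \prod_(i in S) c' i
  = \prod_(i in min_above L) c' i * \prod_(i in ~: L :\: min_above L) (1 + c' i).
Proof.
move=> cL; rewrite (eq_bigl _ _ (fun S => up_eq_setC S cL)).
by apply: sum_prod_interval; apply/subsetP => m /min_aboveP[]; rewrite inE.
Qed.

Lemma cut_sub_ideal L (T : {set I}) x :
  cut L -> x \in T -> x \notin L -> L \subset ideal le T.
Proof. by move=> cL xT nxL; apply/subsetP => y yL; apply/idealP; exists x => //; apply: cL. Qed.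

(** As soon as [T] leaves [L], its ideal contains all of [L] and a further point. *)
Lemma card_ideal_cut L (T : {set I}) : cut L -> (#|ideal le T| <= #|L|)%N = (T \subset L).
Proof.
move=> cL; apply/idP/idP => [leT|]; last first.
  by rewrite -(ideal_sub po) => [/subset_leq_card //|x y]; apply: cut_closed.
apply/subsetP => x xT; apply: contraLR leT => nxL; rewrite -ltnNge.
apply/proper_card/properP; split; first exact: cut_sub_ideal xT nxL.
by exists x => //; apply: (subsetP (sub_ideal po T)).
Qed.

Lemma natr_h_neq0 i : (h i)%:R != 0 :> algC.
Proof. by rewrite pnatr_eq0 -lt0n (leq_trans _ (h_ge2 i)). Qed.

Lemma natr_h_gt1 i : 0 < (h i)%:R - 1 :> algC.
Proof. by rewrite subr_gt0 ltr1n. Qed.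

Lemma punctured_sum_neq0 T i : c T i != 0.
Proof.
rewrite /punctured_sum; case: ifP => _; first by rewrite oppr_eq0 oner_eq0.
by rewrite gt_eqF ?natr_h_gt1.
Qed.

Lemma add1_punctured_sum T i : 1 + c T i = (h i)%:R *+ (i \notin T).
Proof. by rewrite /punctured_sum; case: ifP => _ /=; rewrite ?subrr // addrC subrK. Qed.

Lemma sum_weight_sum n (S : {set I}) :
  \sum_(k < n) weight_sum h le k S
  = \sum_(E : {set I} | (#|ideal le E| < n)%N) \prod_(i in E) c S i.
Proof.
rewrite /weight_sum (exchange_big_dep predT) //= [RHS]big_mkcond.
apply: eq_bigr => E _.
rewrite (eq_bigl (fun k : 'I_n => k == #|ideal le E| :> nat)) => [|k].
  exact: (big_ord1_eq _ (fun=> \prod_(i in E) c S i)).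
by rewrite eq_sym.
Qed.

(** This identifies the dual block of a character supported on [min_above L]. The weights up to
    [#|L|] force [S] to avoid [L]; the weight [#|L|.+1] then forces [S] to contain [min_above L]. *)
Lemma weight_sum_min_above L (S : {set I}) : cut L ->
  (forall k, weight_sum h le k S = weight_sum h le k (min_above L)) -> up S = ~: L.
Proof.
move=> cL eS; set M := min_above L in eS.
have ML m : m \in M -> m \notin L by case/min_aboveP.
have lowE T : \sum_(k < #|L|.+1) weight_sum h le k T = \prod_(i in L) (1 + c T i).
  rewrite sum_weight_sum (eq_bigl (fun E : {set I} => (set0 \subset E) && (E \subset L))).
    by rewrite sum_prod_interval ?sub0set // big_set0 mul1r setD0.
  by move=> E; rewrite ltnS card_ideal_cut // sub0set.
(* The product in [lowE] has a zero factor if [T] meets [L], and none for [T = M]. *)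
have SL i : i \in L -> i \notin S.
  move=> iL; apply/negP => iS.
  have : \sum_(k < #|L|.+1) weight_sum h le k M = \sum_(k < #|L|.+1) weight_sum h le k S.
    by apply: eq_bigr => k _; rewrite eS.
  rewrite !lowE.
  rewrite [RHS](bigD1 i) //= add1_punctured_sum iS mul0r => /eqP/prodf_eq0[j jL].
  rewrite add1_punctured_sum; case: (boolP (j \in M)) => [/ML|_]; first by rewrite jL.
  by rewrite (negbTE (natr_h_neq0 j)).
apply/eqP; rewrite up_eq_setC //; apply/andP; split; last first.
  by apply/subsetP => i iS; rewrite inE; apply: contraL iS => /SL.
(* On ideals of size [#|L|.+1] every product is smallest when [M \subset S]. *)
have decomp (E : {set I}) : #|ideal le E| = #|L|.+1 ->
    exists m, [/\ m \in M, m \in E & E :\ m \subset L].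
  move=> cE; have : ~~ (E \subset L) by rewrite -card_ideal_cut // cE ltnn.
  case/subsetPn => x xE nxL.
  have LE := cut_sub_ideal cL xE nxL.
  have xi := subsetP (sub_ideal po E) x xE.
  have /eqP idE : x |: L == ideal le E.
    by rewrite eqEcard subUset sub1set xi LE cE cardsU1 nxL add1n leqnn.
  exists x; split=> //.
    apply/min_aboveP; split => // y nyL yx.
    have : y \in ideal le E by apply: (ideal_closed po) yx.
    by rewrite -idE => /setU1P[//|yL]; rewrite yL in nyL.
  apply/subsetP => y /setD1P[nyx /(subsetP (sub_ideal po E))].
  by rewrite -idE => /setU1P[yx|//]; rewrite yx eqxx in nyx.
have diffE (E : {set I}) : #|ideal le E| = #|L|.+1 -> exists m, [/\ m \in M, m \in E &
    \prod_(i in E) c S i - \prod_(i in E) c M i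
    = (c S m + 1) * \prod_(i in E :\ m) ((h i)%:R - 1)].
  move=> /decomp[m [mM mE /subsetP EmL]]; exists m; split=> //.
  have prodE (T : {set I}) : (forall i, i \in L -> i \notin T) ->
      \prod_(i in E) c T i = c T m * \prod_(i in E :\ m) ((h i)%:R - 1).
    move=> TL; rewrite (big_setD1 m) //=; congr (_ * _).
    by apply: eq_bigr => i /EmL/TL; rewrite /punctured_sum => /negbTE ->.
  rewrite !prodE // => [|i iL]; last by apply: contraL iL => /ML.
  by rewrite -mulrBl {2}/punctured_sum mM opprK.
have cS1 m : 0 <= c S m + 1.
  by rewrite addrC add1_punctured_sum; case: (_ \notin _); rewrite ?ler0n.
apply/subsetP => m mM.
(* A vanishing sum of nonnegative differences has only zero terms; the term of [[set m]] is
   [c S m + 1], which vanishes only if [m] is in [S]. *)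
have /eqP : weight_sum h le #|L|.+1 S - weight_sum h le #|L|.+1 M = 0 by rewrite eS subrr.
rewrite /weight_sum -sumrB psumr_eq0 => [/allP/(_ [set m])|E /eqP/diffE[m' [_ _ ->]]];
  last by rewrite mulr_ge0 // prodr_ge0 // => i _; rewrite ltW ?natr_h_gt1.
rewrite mem_index_enum => /(_ isT)/implyP.
have -> : #|ideal le [set m]| = #|L|.+1.
  rewrite (_ : ideal le [set m] = m |: L) ?cardsU1 ?ML //.
  apply/setP => x; apply/idealP/setU1P => [[_ /set1P-> xm]|].
    have [xL|nxL] := boolP (x \in L); first by right.
    by left; move/min_aboveP: mM => [_]; apply.
  by case=> [->|xL]; exists m; rewrite ?set11 //; apply/cL/ML.
move=> /(_ (eqxx _)); rewrite !big_set1 {2}/punctured_sum mM opprK addrC add1_punctured_sum.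
case: (boolP (m \in S)) => //= _; by rewrite mulr1n (negbTE (natr_h_neq0 m)).
Qed.

(** The two sides are the sums, over the block of characters whose supports generate [~: L], at
    codewords with supports [T] and [T']. For the dual order, characters and codewords change
    places. *)
Definition block_sums_by_weight : Prop := forall L (T T' : {set I}), cut L ->
  #|ideal le T| = #|ideal le T'| ->
  \sum_(S | up S == ~: L) \prod_(i in S) c T i
  = \sum_(S | up S == ~: L) \prod_(i in S) c T' i.

Lemma ideal_min_above L (S : {set I}) : cut L -> S \subset min_above L -> S != set0 ->
  ideal le S = L :|: S.
Proof.
move=> cL /subsetP SM /set0Pn[m mS].
apply/setP => x; apply/idealP/setUP => [[b bS xb]|[xL|xS]]; last by exists x.
  have [xL|nxL] := boolP (x \in L); first by left.
  by right; have /min_aboveP[_ /(_ x nxL xb) ->] := SM _ bS.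
by exists m => //; apply: cL => //; have /min_aboveP[] := SM _ mS.
Qed.

Lemma card_ideal_min_above L (S : {set I}) : cut L -> S \subset min_above L -> S != set0 ->
  #|ideal le S| = (#|L| + #|S|)%N.
Proof.
move=> cL SM S0; rewrite (ideal_min_above cL) // cardsU (_ : L :&: S = set0) ?cards0 ?subn0 //.
apply/eqP; rewrite -subset0; apply/subsetP => x /setIP[xL /(subsetP SM)/min_aboveP[]].
by rewrite xL.
Qed.

(** Singletons in [min_above L] share the weight [#|L| + 1], and the block sum at [[set w]] is
    [- (P * Q) / (h w - 1)] with [P] and [Q] independent of [w]. *)
Lemma min_above_h L u v : block_sums_by_weight -> cut L ->
  u \in min_above L -> v \in min_above L -> h u = h v.
Proof.
move=> bs cL uM vM; set M := min_above L in uM vM *.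
have cI w : w \in M -> #|ideal le [set w]| = (#|L| + 1)%N.
  move=> wM; rewrite (card_ideal_min_above cL) ?sub1set ?cards1 //.
  by apply/set0Pn; exists w; rewrite set11.
pose P := \prod_(i in M) ((h i)%:R - 1 : algC).
have P0 : P != 0 by apply/prodf_neq0 => i _; rewrite gt_eqF ?natr_h_gt1.
pose Q := \prod_(i in ~: L :\: M) ((h i)%:R : algC).
have Q0 : Q != 0 by apply/prodf_neq0 => i _; apply: natr_h_neq0.
have val w : w \in M ->
    ((h w)%:R - 1) * \sum_(S | up S == ~: L) \prod_(i in S) c [set w] i = - (P * Q).
  move=> wM; rewrite sum_up_setC // -/M mulrA -mulNr; congr (_ * _).
    rewrite /P !(big_setD1 w wM) /= {1}/punctured_sum set11 mulN1r mulrN.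
    congr (- (_ * _)); apply: eq_bigr => i /setD1P[niw _].
    by rewrite /punctured_sum in_set1 (negbTE niw).
  apply: eq_bigr => i /setDP[_ niM]; rewrite add1_punctured_sum in_set1.
  by have -> : i != w by apply: contraNneq niM => ->.
have := val u uM; rewrite (bs L [set u] [set v]) ?cI // -(val v vM).
have X0 : \sum_(S | up S == ~: L) \prod_(i in S) c [set v] i != 0.
  apply/eqP => X0; have := val v vM; rewrite X0 mulr0 => /esym/eqP.
  by rewrite oppr_eq0 mulf_eq0 (negbTE P0) (negbTE Q0).
by move/(mulIf X0)/addIr/eqP; rewrite eqr_nat => /eqP.
Qed.

(** Otherwise take [y] minimal among the points outside [L :|: M] that are not above [m]. The weight
    of [[set y]] is then also attained by a nonempty [S] inside [M]. The block sum at [[set y]] has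
    the zero factor [1 + c [set y] y], while at [S] no factor vanishes. *)
Lemma cut_extend L : block_sums_by_weight -> cut L -> cut (L :|: min_above L).
Proof.
move=> bs cL m x /setUP[mL|mM]; rewrite in_setU negb_or => /andP[nxL nxM].
  exact: cL.
set M := min_above L in mM nxM *; apply: contraT => nmx.
have [|y [/andP[nyLM nmy] yx min_y]] :=
  @exists_minimal (fun y => (y \notin L :|: M) && ~~ le m y) x.
  by rewrite in_setU negb_or nxL nxM.
have [nyL nyM] : y \notin L /\ y \notin M by apply/norP; rewrite -in_setU.
pose D := ideal le [set y].
have yD : y \in D by apply/idealP; exists y; rewrite ?set11.
have LD : L \subset D by apply: cut_sub_ideal nyL; rewrite ?set11.
have gtD : (#|L| < #|D|)%N by apply/proper_card/properP; split=> //; exists y.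
(* By minimality of [y], everything strictly below it lies in [L :|: M], and [m] does not. *)
have leD : (#|D| <= #|L| + #|M|)%N.
  have : (#|D :\ y| < #|L :|: M|)%N.
    apply/proper_card/properP; split; last first.
      exists m; first by rewrite in_setU mM orbT.
      rewrite !inE; apply/nandP; right; apply/negP => /exists_inP[_ /set1P->].
      exact/negP.
    apply/subsetP => z /setD1P[nzy /idealP[_ /set1P-> zy]].
    apply: contraNT nzy => nz; rewrite (min_y z) // nz /=.
    by apply: contra nmy => mz; apply: le_trans zy.
  rewrite cardsU [#|D|](cardsD1 y) yD add1n => /leq_trans; apply; exact: leq_subr.
have [S [SM cS]] : exists S : {set I}, S \subset M /\ #|S| = (#|D| - #|L|)%N.
  exists [set z in take (#|D| - #|L|)%N (enum M)]; split.
    by apply/subsetP => z; rewrite inE => /mem_take; rewrite mem_enum.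
  rewrite cardsE (card_uniqP _) ?take_uniq ?enum_uniq // size_takel // -cardE.
  by rewrite leq_subLR.
have S0 : S != set0 by rewrite -card_gt0 cS subn_gt0.
have cI : #|ideal le S| = #|ideal le [set y]|.
  by rewrite (card_ideal_min_above cL) // cS subnKC // ltnW.
have := bs L _ _ cL cI; rewrite !sum_up_setC // -/M => /eqP.
rewrite [X in _ == _ * X](bigD1 y) /=; last by rewrite in_setD in_setC nyM.
rewrite add1_punctured_sum set11 mulr0n mul0r mulr0 mulf_eq0 => /orP[] /prodf_eq0[i].
  by move=> _; rewrite (negbTE (punctured_sum_neq0 S i)).
case/setDP=> _ niM; rewrite add1_punctured_sum.
have -> : i \notin S by apply: contra niM; apply: (subsetP SM).
by rewrite (negbTE (natr_h_neq0 i)).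
Qed.

(* Peel off the levels of the order one at a time, starting from the bottom. *)
Lemma weak_order_of_block_sums :
  block_sums_by_weight -> weak_order le /\ constant_on_incomparable le h.
Proof.
move=> bs.
(* Restricting to elements outside a cut permits induction on the size of [~: L]; the empty cut
   gives the claim. *)
suff H L : cut L ->
  (forall u v w, u \notin L -> v \notin L -> w \notin L ->
     strict le u v -> strict le u w || strict le w v) /\
  (forall u v, u \notin L -> v \notin L ->
     ~~ strict le u v -> ~~ strict le v u -> h u = h v).
  have [|wo hc] := H set0; first by move=> x y; rewrite inE.
  by split=> [u v w|u v]; [apply: wo | apply: hc]; rewrite inE.
have [n] := ubnP #|~: L|; elim: n L => // n IHn L ltn cL.
have [LT|/subsetPn[x _ nxL]] := boolP (setT \subset L).
  have inL x : x \in L by apply: (subsetP LT).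
  by split=> [u v w|u v]; rewrite inL.
pose M := min_above L; have cL' := cut_extend bs cL.
have strictM m z : m \in L :|: M -> z \notin L :|: M -> strict le m z.
  move=> mL' zL'; rewrite /strict cL' //=.
  by apply: contraNneq zL' => <-.
have [|//|wo hc] := IHn (L :|: M).
  rewrite -ltnS; apply: leq_trans _ ltn; rewrite ltnS; apply/proper_card/properP; split.
    by rewrite setCS subsetUl.
  have [m mM _] := min_above_below nxL.
  by exists m; rewrite !in_setC; [case/min_aboveP: mM | rewrite negbK in_setU mM orbT].
split=> [u v w nuL nvL nwL uv|u v nuL nvL nuv nvu].
  have nvL' : v \notin L :|: M.
    rewrite in_setU (negbTE nvL); apply/negP => /min_aboveP[_ min_v].
    by case/andP: uv => uv /eqP; apply; apply: min_v.
  have [wL'|nwL'] := boolP (w \in L :|: M); first by rewrite (strictM w v) ?orbT.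
  have [uL'|nuL'] := boolP (u \in L :|: M); first by rewrite strictM.
  exact: wo.
have [uL'|nuL'] := boolP (u \in L :|: M).
  have [vL'|nvL'] := boolP (v \in L :|: M); last by rewrite strictM in nuv.
  move: uL' vL'; rewrite !in_setU (negbTE nuL) (negbTE nvL).
  exact: min_above_h.
have [vL'|nvL'] := boolP (v \in L :|: M); first by rewrite strictM in nvu.
exact: hc.
Qed.

End Cuts.

(** * Characters of finite abelian groups *)

Lemma exists_dsupp (I : finType) (Z : I -> finType) (z0 : forall i, Z i) (E : {set I}) :
  (forall i, 2 <= #|Z i|)%N -> exists b : {dffun forall i, Z i}, dsupp z0 b = E.
Proof.
move=> cZ; have /fin_all_exists[z zP] i : exists z : Z i, z != z0 i.
  have : (0 < #|predC1 (z0 i)|)%N by rewrite cardC1 -subn1 subn_gt0.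
  by case/card_gt0P=> z; rewrite inE => nz; exists z.
exists [ffun i => if i \in E then z i else z0 i]; apply/setP => i.
by rewrite inE ffunE; case: ifP; rewrite ?zP ?eqxx.
Qed.

Section AbelianCharacters.

Variables (gT : finGroupType) (abG : abelian [set: gT]).
Local Notation Irr := (Iirr [set: gT]%G).

Lemma abelian_irr1 (y : Irr) : 'chi_y 1%g = 1.
Proof. by rewrite lin_char1 //; apply: char_abelianP. Qed.

Lemma abelian_irr0 (x : gT) : 'chi[[set: gT]%G]_0 x = 1.
Proof. by rewrite irr0 cfun1E inE. Qed.

Lemma abelian_irr_orthogonal (y y' : Irr) :
  \sum_x 'chi_y x * ('chi_y' x)^* = #|gT|%:R *+ (y == y').
Proof.
have cG0 : #|gT|%:R != 0 :> algC.
  by rewrite pnatr_eq0 -lt0n; apply/card_gt0P; exists 1%g.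
rewrite -[LHS](mulVKf cG0) -[RHS]mulr_natr -cfdot_irr cfdotE cardsT.
by congr (_ * (_ * _)); apply: eq_bigl => x; rewrite inE.
Qed.

Lemma abelian_elt_orthogonal (x x' : gT) :
  \sum_(y : Irr) 'chi_y x * ('chi_y x')^* = #|gT|%:R *+ (x == x').
Proof.
have abx z : 'C[z]%g = [set: gT].
  apply/eqP; rewrite eqEsubset subsetT sub_cent1.
  by rewrite (subsetP abG) // inE.
rewrite second_orthogonality_relation ?inE // setTI abx cardsT.
by rewrite (abelian_classP _ abG) ?inE.
Qed.

Lemma abelian_irr_sum (y : Irr) : \sum_x 'chi_y x = #|gT|%:R *+ (y == 0).
Proof.
rewrite -abelian_irr_orthogonal; apply: eq_bigr => x _.
by rewrite abelian_irr0 conjC1 mulr1.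
Qed.

Lemma abelian_elt_sum (x : gT) : \sum_(y : Irr) 'chi_y x = #|gT|%:R *+ (x == 1%g).
Proof.
rewrite -abelian_elt_orthogonal; apply: eq_bigr => y _.
by rewrite abelian_irr1 conjC1 mulr1.
Qed.

End AbelianCharacters.

(** * Weight partitions of codewords and of characters *)

Section WeightPartitions.

Variables (I : finType) (H : I -> finGroupType) (le : rel I).
Hypotheses (hab : forall i, abelian [set: H i]) (hcard : forall i, (2 <= #|H i|)%N).
Hypothesis po : is_poset le.

Local Notation h := (fun i => #|H i|).
Local Notation up := (ideal (dual_order le)).
Local Notation Q := (@Qrel I H le).
Local Notation Qhat := (@Qhat_rel I H le).
Local Notation ev := (@char_ev I H).
Local Notation Lam := (dual_rel ev Q).

Lemma supp_chE (a : prodHhat H) :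
  supp_ch a = dsupp (fun i => 0 : Iirr [set: H i]%G) a.
Proof. by apply/setP => i; rewrite !inE irr_eq1. Qed.

Lemma sum_el_supp (p : pred {set I}) (a : prodHhat H) :
  \sum_(b | p (supp_el b)) ev a b
  = \sum_(E | p E) \prod_(i in E) punctured_sum h (supp_ch a) i.
Proof.
rewrite supp_chE.
apply: (@sum_over_support I H (fun i => Iirr [set: H i]%G) (fun i => 1%g) _
          (fun i y x => 'chi_y x)) => i y; first exact: abelian_irr1.
exact: abelian_irr_sum.
Qed.

Lemma sum_ch_supp (p : pred {set I}) (b : prodH H) :
  \sum_(a | p (supp_ch a)) ev a b
  = \sum_(E | p E) \prod_(i in E) punctured_sum h (supp_el b) i.
Proof.
under eq_bigl => a do rewrite supp_chE.
apply: (@sum_over_support I (fun i => Iirr [set: H i]%G) H _ (fun i => 1%g)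
          (fun i x y => 'chi_y x)) => i x; first exact: abelian_irr0.
exact: abelian_elt_sum.
Qed.

Lemma exists_supp_el (E : {set I}) : exists b : prodH H, supp_el b = E.
Proof. exact: exists_dsupp. Qed.

Lemma exists_supp_ch (E : {set I}) : exists a : prodHhat H, supp_ch a = E.
Proof.
have [i|a aE] := @exists_dsupp I (fun i => Iirr [set: H i]%G) (fun i => 0) E.
  by rewrite card_Iirr_abelian ?cardsT ?hcard ?hab.
by exists a; rewrite supp_chE.
Qed.

Lemma sum_block_el (b : prodH H) (a : prodHhat H) :
  \sum_(x | Q b x) ev a x = weight_sum h le (wt_el le b) (supp_ch a).
Proof.
rewrite /weight_sum -(sum_el_supp (fun E => #|ideal le E| == wt_el le b)).
by apply: eq_bigl => x; rewrite /Qrel eq_sym.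
Qed.

Lemma sum_block_ch (a : prodHhat H) (b : prodH H) :
  \sum_(x | Qhat a x) ev x b
  = weight_sum h (dual_order le) (wt_ch (dual_order le) a) (supp_el b).
Proof.
rewrite /weight_sum.
rewrite -(sum_ch_supp (fun E => #|up E| == wt_ch (dual_order le) a)).
by apply: eq_bigl => x; rewrite /Qhat_rel eq_sym.
Qed.

Lemma dual_QP (a a' : prodHhat H) :
  reflect (forall k, weight_sum h le k (supp_ch a) = weight_sum h le k (supp_ch a'))
          (Lam a a').
Proof.
apply: (iffP forallP) => [aa k|aa b]; last by rewrite !sum_block_el aa.
have [/existsP[E /eqP Ek]|] := boolP [exists E : {set I}, #|ideal le E| == k].
  have [b bE] := exists_supp_el E.
  by have := eqP (aa b); rewrite !sum_block_el /wt_el bE Ek.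
(* If no set has an ideal of size [k], both sums are empty. *)
rewrite negb_exists => /forallP nE; rewrite /weight_sum !big1 // => E Ek.
  by have := nE E; rewrite Ek.
by have := nE E; rewrite Ek.
Qed.

(** The block of [Lam] through a character supported on [min_above le L] consists of the characters
    whose supports generate [~: L]. Reflexivity makes its sum constant on codewords of equal
    weight. *)
Lemma weak_order_of_reflexive :
  fourier_reflexive ev Q -> weak_order le /\ constant_on_incomparable le h.
Proof.
move=> refl; apply: weak_order_of_block_sums => // L T T' cL eT.
have [b bT] := exists_supp_el T; have [b' bT'] := exists_supp_el T'.
have [a aM] := exists_supp_ch (min_above le L).
have upM : up (min_above le L) == ~: L.
  rewrite up_eq_setC // subxx; apply/subsetP => m /min_aboveP[].
  by rewrite inE.
have LamE a' : Lam a a' = (up (supp_ch a') == ~: L).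
  apply/dual_QP/eqP => [aa|ea' k].
    by apply: (@weight_sum_min_above I h) => // k; rewrite -aa aM.
  by rewrite weight_sum_up // aM (eqP upM) -ea' -weight_sum_up.
have : bidual_rel ev Q b b' by rewrite refl /Qrel /wt_el bT bT' eT.
move=> /forallP/(_ a)/eqP; rewrite !(eq_bigl _ _ LamE).
by rewrite !(sum_ch_supp (fun S => up S == ~: L)) bT bT'.
Qed.

(** The peeling is applied to the dual order, with blocks of codewords instead of characters. Those
    blocks are given by weight alone, so [up_card_setC] is what describes them by ideals. *)
Lemma weak_order_of_dual :
  (forall a c, Lam a c = Qhat a c) -> weak_order le /\ constant_on_incomparable le h.
Proof.
move=> LamQ; have pod := is_poset_dual po.
suff [wo hc] : weak_order (dual_order le) /\ constant_on_incomparable (dual_order le) h.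
  by split; [exact: weak_order_dual wo | exact: constant_on_incomparable_dual hc].
apply: weak_order_of_block_sums => // L T T' cL eT.
have [a aT] := exists_supp_ch T; have [a' aT'] := exists_supp_ch T'.
have [b bM] := exists_supp_el (min_above (dual_order le) L).
have idM : ideal le (min_above (dual_order le) L) == ~: L.
  have -> := up_eq_setC pod (min_above (dual_order le) L) cL.
  by rewrite subxx; apply/subsetP => m /min_aboveP[]; rewrite inE.
have QE b' : Q b b' = (ideal le (supp_el b') == ~: L).
  rewrite /Qrel /wt_el bM (eqP idM) eq_sym.
  exact: (up_card_setC pod (supp_el b') cL).
have : Lam a a' by rewrite LamQ /Qhat_rel /wt_ch aT aT' eT.
move=> /forallP/(_ b)/eqP; rewrite !(eq_bigl _ _ QE).
by rewrite !(sum_el_supp (fun S => ideal le S == ~: L)) aT aT'.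
Qed.

(** Of the inclusions required by [mutual_duality], two come from [weight_sum_card] for the order
    and its dual, and two from Fourier inversion on either side. *)
Lemma duality_of_weak_order :
  weak_order le -> constant_on_incomparable le h ->
  Lam =2 Qhat /\ fourier_reflexive ev Q.
Proof.
move=> wo hc; have N0 : \prod_(i : I) #|H i|%:R != 0 :> algC.
  by apply/prodf_neq0 => i _; rewrite pnatr_eq0 -lt0n (leq_trans _ (hcard i)).
apply: mutual_duality.
- by move=> x y z; rewrite /Qrel eqxx; split=> // /eqP->.
- by move=> x y z; rewrite /Qhat_rel eqxx; split=> // /eqP->.
- by move=> a a' /eqP aa; apply/dual_QP => k; apply: weight_sum_card.
- move=> b b' /eqP bb; apply/forallP => a; rewrite !sum_block_ch; apply/eqP.
  apply: weight_sum_card => //; first exact: is_poset_dual.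
    exact: weak_order_dual.
  exact: constant_on_incomparable_dual.
- move=> b b'; apply: (bidual_rel_sub N0); first by move=> x; rewrite /Qrel eqxx.
  move=> x x'; apply: (@orthogonality_prod I H (fun i => Iirr [set: H i]%G)
                         (fun i y x => 'chi_y x)) => i.
  exact: abelian_elt_orthogonal.
- move=> a a'; apply: (bidual_rel_sub N0); first by move=> x; rewrite /Qhat_rel eqxx.
  move=> x x'; apply: (@orthogonality_prod I (fun i => Iirr [set: H i]%G) H
                         (fun i x y => 'chi_y x)) => i.
  exact: abelian_irr_orthogonal.
Qed.

End WeightPartitions.

Theorem theorem2p4 (I : finType) (H : I -> finGroupType) (le : rel I)
  (hab : forall i, abelian [set: H i])
  (hcard : forall i, (2 <= #|H i|)%N)
  (hpo : is_poset le) :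
  [<-> fourier_reflexive (@char_ev I H) (@Qrel I H le);
       forall a c, dual_rel (@char_ev I H) (@Qrel I H le) a c = @Qhat_rel I H le a c;
       hierarchical le /\ (forall u v, len le u = len le v -> #|H u| = #|H v|)].
Proof.
have hierP := hierarchicalP hpo (fun i => #|H i|).
tfae.
- move/(weak_order_of_reflexive hab hcard hpo) => [wo hc].
  by have [] := duality_of_weak_order hab hcard hpo wo hc.
- by move/(weak_order_of_dual hab hcard hpo)/hierP.
- move/hierP => [wo hc].
  by have [] := duality_of_weak_order hab hcard hpo wo hc.
Qed.
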